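(* Let $n$ be a positive integer and let $T\colon M_n \rightarrow M_n$ be a linear operator that preserves Hadamard circulant majorization. Then the Drazin inverse $T^D$ of $T$ also preserves Hadamard circulant majorization.
   Context: $M_n$ is the real vector space of all $n\times n$ real matrices, and $\mathbb{N}_n=\{1,\ldots,n\}$. Let $C:=[\mathbf{e}_n,\mathbf{e}_1,\ldots,\mathbf{e}_{n-1}]$ be the $n\times n$ matrix with the indicated columns, where $\mathbf{e}_i$ is the $i$th standard basis vector of $\mathbb{R}^n$; for $i\in\mathbb{N}_n$ put $C_i:=C^i$ (the $i$th power). A matrix in $M_n$ is called circulant doubly stochastic if it is a convex combination of $C_1,\ldots,C_n$. For $X=[x_{ij}],Y=[y_{ij}]\in M_n$, the Hadamard product is $X\odot Y:=[x_{ij}y_{ij}]$. We write $X\prec_{HC}Y$ ($X$ is Hadamard circulant majorized by $Y$) if there is a circulant doubly stochastic matrix $D\in M_n$ with $X=D\odot Y$. A linear operator $T\colon M_n\to M_n$ preserves Hadamard circulant majorization if $T(X)\prec_{HC}T(Y)$ whenever $X\prec_{HC}Y$. The index of a linear operator $T\colon M_n\to M_n$ is the smallest nonnegative integer $m$ such that $\operatorname{rank} T^m=\operatorname{rank} T^{m+1}$ (it always exists). With $m$ the index of $T$, the Drazin inverse $T^D$ is the unique linear operator $U\colon M_n\to M_n$ satisfying $T^mUT=T^m$, $UTU=U$ and $UT=TU$. *)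

(* Defs.v *)
From mathcomp Require Import all_boot all_order all_algebra.
From mathcomp Require Import reals.
Set Implicit Arguments.
Unset Strict Implicit.
Unset Printing Implicit Defensive.
Import Order.TTheory GRing.Theory Num.Theory.
Local Open Scope ring_scope.

Section DrazinInverse.
Variables (F : fieldType) (vT : vectType F).
Implicit Types T U V : 'End(vT).

Definition lfun_pow T m : 'End(vT) := iter m (comp_lfun T) \1%VF.

Definition lfun_rank T : nat := \dim (limg T).

Lemma lfun_powE T m x : lfun_pow T m x = iter m T x.
Proof. by elim: m => [|m IHm]; rewrite /= ?id_lfunE // comp_lfunE IHm. Qed.

Lemma limg_powS T m : (limg (lfun_pow T m.+1) <= limg (lfun_pow T m))%VS.
Proof.
apply/subvP => y /memv_imgP[x _ ->].
by rewrite lfun_powE iterSr -lfun_powE memv_img ?memvf.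
Qed.

Lemma lfun_index_subproof T :
  exists m, lfun_rank (lfun_pow T m) == lfun_rank (lfun_pow T m.+1).
Proof.
suff H k : (exists m, lfun_rank (lfun_pow T m) == lfun_rank (lfun_pow T m.+1))
    \/ (lfun_rank (lfun_pow T k) + k <= \dim {:vT})%N.
  by case: (H (\dim {:vT}).+1) => // /(leq_trans (leq_addl _ _)); rewrite ltnn.
elim: k => [|k [IHk|IHk]]; [right | by left | ].
  by rewrite addn0 dimvS ?subvf.
have := dimvS (limg_powS T k); rewrite leq_eqVlt => /orP[/eqP e|lt_k].
  by left; exists k; rewrite /lfun_rank e.
by right; rewrite addnS -addSn (leq_trans _ IHk) // leq_add2r.
Qed.

Definition lfun_index T : nat := ex_minn (lfun_index_subproof T).

Definition is_drazin_inverse T U : bool :=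
  let Tm := lfun_pow T (lfun_index T) in
  [&& (Tm \o U \o T)%VF == Tm, (U \o T \o U)%VF == U & (U \o T)%VF == (T \o U)%VF].

Lemma limg_pow_index T k :
  limg (lfun_pow T (lfun_index T + k)) = limg (lfun_pow T (lfun_index T)).
Proof.
have e1 : limg (lfun_pow T (lfun_index T).+1) = limg (lfun_pow T (lfun_index T)).
  apply/eqP; rewrite eqEdim limg_powS /=.
  by rewrite /lfun_index; case: ex_minnP => m /eqP e _; rewrite -/(lfun_rank _) e.
by elim: k => [|k IHk]; rewrite ?addn0 // addnS /= limg_comp IHk -limg_comp e1.
Qed.

Lemma lker_pow_index T k :
  lker (lfun_pow T (lfun_index T + k)) = lker (lfun_pow T (lfun_index T)).
Proof.
apply/esym/eqP; rewrite eqEdim; apply/andP; split.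
  apply/subvP => x; rewrite !memv_ker !lfun_powE addnC iterD => /eqP ->.
  by rewrite -lfun_powE linear0.
have d f : \dim (lker f) = (\dim {:vT} - lfun_rank f)%N.
  by rewrite -(limg_ker_dim f fullv) capfv addnK.
by rewrite !d /lfun_rank limg_pow_index.
Qed.

Lemma drazin_exists T : exists U, is_drazin_inverse T U.
Proof.
set m := lfun_index T.
pose K := lfun_pow T (m + m.+1); pose G := (K^-1)%VF.
have fact1 x : K (G (iter m T x)) = iter m T x.
  apply: limg_lfunVK; rewrite limg_pow_index -lfun_powE memv_img ?memvf //.
have fact2 x : iter m T (G (K x)) = iter m T x.
  apply/eqP; rewrite -!lfun_powE -subr_eq0 -linearB -memv_ker.
  rewrite -(lker_pow_index T m.+1) memv_ker linearB subr_eq0.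
  by apply/eqP/limg_lfunVK; rewrite memv_img ?memvf.
have KE x : K x = iter m T (T (iter m T x)).
  by rewrite /K lfun_powE iterD.
have com x : iter m T (T x) = T (iter m T x) by rewrite -iterSr.
have comK x : K (T x) = T (K x) by rewrite /K !lfun_powE -iterSr.
have [U UE] : exists U : 'End(vT), forall x, U x = iter m T (G (iter m T x)).
  exists (lfun_pow T m \o G \o lfun_pow T m)%VF => x.
  by rewrite !comp_lfunE !lfun_powE.
have UT x : U (T x) = T (U x).
  by rewrite !UE com -[in LHS](fact1 x) -comK fact2 com.
exists U; apply/and3P; split; apply/eqP/lfunP => x; rewrite !comp_lfunE //.
- by rewrite !lfun_powE UT UE -KE fact1.
- by rewrite UE [in LHS]UE -KE fact2 UE.
Qed.

Lemma drazin_unique T U V :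
  is_drazin_inverse T U -> is_drazin_inverse T V -> U = V.
Proof.
rewrite /is_drazin_inverse; set m := lfun_index T.
have main W : [&& (lfun_pow T m \o W \o T)%VF == lfun_pow T m,
    (W \o T \o W)%VF == W & (W \o T)%VF == (T \o W)%VF] ->
    [/\ forall x, W (iter m T (T x)) = iter m T x,
        forall x, iter m T (T (W x)) = iter m T x,
        forall x, W x = iter m T (iter m.+1 W x) &
        forall x, W x = iter m.+1 W (iter m T x)].
  case/and3P => /eqP/lfunP h1 /eqP/lfunP h2 /eqP/lfunP h3.
  have WT x : W (T x) = T (W x) by have := h3 x; rewrite !comp_lfunE.
  have WTW x : W (T (W x)) = W x by have := h2 x; rewrite !comp_lfunE.
  have WTi k x : W (iter k T x) = iter k T (W x).
    by elim: k => //= k IHk; rewrite WT IHk.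
  have H k x : W x = iter k T (iter k.+1 W x).
    elim: k x => // k IHk x.
    by rewrite iterS [iter k.+2 W x]iterSr -IHk -WT WTW.
  have WiT k j x : iter j W (iter k T x) = iter k T (iter j W x).
    by elim: j => //= j ->; rewrite WTi.
  have TmTW x : iter m T (T (W x)) = iter m T x.
    by have := h1 x; rewrite !comp_lfunE !lfun_powE WT.
  split=> [x|//|x|x]; last by rewrite WiT -H.
    by rewrite WTi WT.
  exact: H.
move=> /main[_ u1 u2 _] /main[v1 _ _ v3]; apply/lfunP => x.
have uVT : U x = V (T (U x)).
  by rewrite u2 -[T (iter m T _)]iterS [iter m.+1 T _]iterSr v1.
have TUV : V x = V (T (U x)).
  by rewrite [LHS]v3 [RHS]v3 u1.
by rewrite uVT -TUV.
Qed.

(* The chosen operator is the only possible one, by drazin_unique. *)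
Definition drazin_inverse T : 'End(vT) := xchoose (drazin_exists T).

Lemma drazin_inverseP T : is_drazin_inverse T (drazin_inverse T).
Proof. exact: xchooseP. Qed.

End DrazinInverse.

Section HadamardCirculantMajorization.
Variables (R : realType) (n : nat).
Implicit Types X Y D : 'M[R]_n.

(* With 0-based indices, column j is the basis vector of index j - 1 mod n. *)
Definition circ_shift : 'M[R]_n := \matrix_(i, j) (i == ord_pred j)%:R.

Definition circulant_doubly_stochastic D : Prop :=
  exists c : 'I_n -> R,
    [/\ forall i, 0 <= c i, \sum_i c i = 1
      & D = \sum_i c i *: circ_shift ^+ i.+1].

Definition hadamard X Y : 'M[R]_n := map2_mx *%R X Y.

Definition HC_majorized X Y : Prop :=
  exists2 D, circulant_doubly_stochastic D & X = hadamard D Y.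

Definition preserves_HC_majorization (T : 'End('M[R]_n)) : Prop :=
  forall X Y, HC_majorized X Y -> HC_majorized (T X) (T Y).

End HadamardCirculantMajorization.

(* Main.v *)
(* Write P_k for the projection of M_n onto the matrices supported on the k-th
   circulant diagonal, so that X is majorized by Y iff X = \sum_k c_k P_k Y for
   some probability vector c.  Testing T on sums of two vectors from different
   blocks shows that its block matrix has at most one nonzero block in each row
   and column; completing this partial injection to a permutation s, T preserves
   majorization iff P_l T = T P_(s l) for all l, the converse because T then just
   permutes the weights c.  Such an intertwining relation passes to the Drazin
   inverse U, with s replaced by its inverse: the projection T U = T^k U^k =
   U^k T^k (k > index) commutes with every P_l, by the argument showing that U
   lies in the double commutant of T. *)
Require Import Defs.
From HB Require Import structures.
From mathcomp Require Import all_boot all_order all_algebra reals.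
From mathcomp Require Import perm.

Set Implicit Arguments.
Unset Strict Implicit.
Unset Printing Implicit Defensive.
Import Order.TTheory GRing.Theory Num.Theory.
Local Open Scope ring_scope.

(** * Extension of a partial injection to a permutation *)

Lemma partial_injection_extends_perm (I : finType) (e : rel I) :
    (forall i j k, e i j -> e i k -> j = k) ->
    (forall i j k, e i k -> e j k -> i = j) ->
  exists s : {perm I}, forall i j, e i j -> j = s i.
Proof.
move=> funE injE; pose f i := odflt i [pick j | e i j].
have fE i j : e i j -> f i = j.
  move=> eij; rewrite /f; case: pickP => [k eik|/(_ j)]; last by rewrite eij.
  exact: funE eik eij.
pose D := [set i | [exists j, e i j]].
have fD i : i \in D -> e i (f i).
  by rewrite inE => /existsP[j eij]; rewrite (fE _ _ eij).
have f_inj : {in D &, injective f}.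
  by move=> i j /fD + /fD + fij; rewrite fij; exact: injE.
pose B := f @: D.
have szE : size (enum (~: B)) = size (enum (~: D)).
  by rewrite -!cardE (cardsCs (~: B)) (cardsCs (~: D)) !setCK card_in_imset.
(* Off the domain, the complements of [D] and [B], equal in size by [szE], are matched in
   enumeration order. *)
pose g i := if i \in D then f i else nth i (enum (~: B)) (index i (enum (~: D))).
have gC i : i \notin D ->
    (index i (enum (~: D)) < size (enum (~: B)))%N.
  by move=> iD; rewrite szE index_mem mem_enum inE.
have gB i : (g i \in B) = (i \in D).
  rewrite /g; have [iD|iD] := boolP (i \in D); first exact: imset_f.
  by apply/negbTE; rewrite -in_setC -mem_enum mem_nth ?gC.
have g_inj : injective g.
  move=> i j gij; have := congr1 (mem B) gij; rewrite /= !gB => Dij.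
  move: gij; rewrite /g -Dij; have [iD|iD] := boolP (i \in D).
    by apply: f_inj; rewrite // -Dij.
  have jD : j \notin D by rewrite -Dij.
  (* [g i] and [g j] use the defaults [i] and [j]; [nth_uniq] needs a common one. *)
  rewrite (set_nth_default i j) ?gC // => /eqP.
  rewrite nth_uniq ?enum_uniq ?gC // => /eqP ij.
  have iK x : x \notin D -> nth i (enum (~: D)) (index x (enum (~: D))) = x.
    by move=> xD; rewrite nth_index // mem_enum in_setC.
  by rewrite -(iK i iD) ij iK.
exists (perm g_inj) => i j eij; rewrite permE /g.
have -> : i \in D by rewrite inE; apply/existsP; exists j.
by rewrite (fE i j).
Qed.

(** * Intertwining relations and the Drazin inverse *)

Section DrazinIntertwining.
Variables (F : fieldType) (vT : vectType F) (I : finType).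
Variables (P : I -> 'End(vT)) (s : {perm I}) (T U : 'End(vT)) (m : nat).
Hypothesis PT : forall i x, P i (T x) = T (P (s i) x).
Hypothesis UT : forall x, U (T x) = T (U x).
Hypothesis UTU : forall x, U (T (U x)) = U x.
Hypothesis TmTU : forall x, iter m T (T (U x)) = iter m T x.

(** Exponents start at 1: zeroth powers would give the identity, not the projection [T U]. *)
Lemma iter_TU_l j x : iter j.+1 T (iter j.+1 U x) = T (U x).
Proof.
elim: j x => // j IHj x.
by rewrite iterS [iter j.+2 U x]iterSr IHj -(UT (U x)) UTU.
Qed.

Lemma iter_TU_r j x : iter j.+1 U (iter j.+1 T x) = T (U x).
Proof.
elim: j x => [x|j IHj x]; first exact: UT.
by rewrite iterS [iter j.+2 T x]iterSr IHj UTU UT.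
Qed.

Lemma iter_T_TU j x : iter j T (T (U x)) = T (U (iter j T x)).
Proof. by elim: j => //= j ->; rewrite UT. Qed.

Lemma intertwining_iter j i x : P i (iter j T x) = iter j T (P (iter j s i) x).
Proof. by elim: j i => //= j IHj i; rewrite PT IHj -iterSr. Qed.

Lemma intertwining_iterV j i :
  exists i', forall x, iter j T (P i x) = P i' (iter j T x).
Proof.
exists (iter j (s^-1)%g i) => x.
rewrite intertwining_iter; congr (iter j T (P _ x)).
by elim: j => //= j IHj; rewrite -iterS iterSr permKV.
Qed.

(** Let E = TU and k = m+1, so T^k E = T^k. Moving P_i through the T^k of E = T^k U^k gives E P_i E
    = P_i E; moving it through that of E = U^k T^k gives E P_i E = E P_i. *)
Lemma TU_comm i x : P i (T (U x)) = T (U (P i x)).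
Proof.
have TmS y : iter m.+1 T (T (U y)) = iter m.+1 T y by rewrite !iterS TmTU.
have TUP_TU : T (U (P i (T (U x)))) = P i (T (U x)).
  by rewrite -(iter_TU_l m x) intertwining_iter -iter_T_TU TmS.
have [i' TP] := intertwining_iterV m.+1 i.
by rewrite -TUP_TU -[LHS](iter_TU_r m) TP TmS -TP iter_TU_r.
Qed.

(** With j = s^-1 i: U P_j = U (TU) P_j = U P_j T U = U T P_i U = P_i (TU) U = P_i U. *)
Lemma drazin_intertwining i x : P i (U x) = U (P ((s^-1)%g i) x).
Proof.
by rewrite -[RHS]UTU -TU_comm PT permKV UT -TU_comm -UT UTU.
Qed.

End DrazinIntertwining.

Lemma drazin_inverse_intertwining (F : fieldType) (vT : vectType F)
    (I : finType) (P : I -> 'End(vT)) (s : {perm I}) (T : 'End(vT)) :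
    (forall i x, P i (T x) = T (P (s i) x)) ->
  forall i x, P i (drazin_inverse T x) = drazin_inverse T (P ((s^-1)%g i) x).
Proof.
move=> PT; case/and3P: (drazin_inverseP T).
move: (drazin_inverse T) (lfun_index T) => U m.
move=> /eqP/lfunP TUT /eqP/lfunP UTU /eqP/lfunP UT.
have {}UT x : U (T x) = T (U x) by have := UT x; rewrite !comp_lfunE.
apply: (drazin_intertwining (m := m)) => // x.
  by have := UTU x; rewrite !comp_lfunE.
by have := TUT x; rewrite !comp_lfunE !lfun_powE UT.
Qed.

(** * Majorization relative to a complete family of projections *)

Section BlockMajorization.
Variables (R : realFieldType) (V : vectType R) (I : finType).
Variable P : I -> 'End(V).
Hypothesis PP : forall k l x, P k (P l x) = if k == l then P l x else 0.
Hypothesis sumP : forall x, \sum_k P k x = x.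
Implicit Types T : 'End(V).

Definition block_majorized (x y : V) : Prop :=
  exists2 c : I -> R, (forall i, 0 <= c i) /\ \sum_i c i = 1
    & x = \sum_i c i *: P i y.

Definition preserves_block_majorization T : Prop :=
  forall x y, block_majorized x y -> block_majorized (T x) (T y).

Lemma proj_weighted_sum (c : I -> R) l y :
  P l (\sum_i c i *: P i y) = c l *: P l y.
Proof.
rewrite linear_sum (bigD1 l) //= linearZ /= PP eqxx big1 ?addr0 // => i il.
by rewrite linearZ /= PP eq_sym (negbTE il) scaler0.
Qed.

Lemma proj_majorized k y : block_majorized (P k y) y.
Proof.
exists (fun i => (i == k)%:R).
  split=> [i|]; first exact: ler0n.
  by rewrite (bigD1 k) //= eqxx big1 ?addr0 // => i /negbTE ->.
rewrite (bigD1 k) //= eqxx scale1r big1 ?addr0 // => i /negbTE ->.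
by rewrite scale0r.
Qed.

(** Since P_j x is majorized by P_j x + r P_k y, for every r the vector u is a multiple of u + r v.
    Taking r = 1 makes v = t u with t nonzero; then r = -1/t forces u = 0. *)
Lemma block_row_unique T l j k x y : preserves_block_majorization T ->
  P l (T (P j x)) != 0 -> P l (T (P k y)) != 0 -> j = k.
Proof.
move=> hT u0 v0; apply/eqP; apply: contraT => jk.
set u := P l _ in u0; set v := P l _ in v0.
have main (r : R) : exists c, u = c *: (u + r *: v).
  have := hT _ _ (proj_majorized j (P j x + r *: P k y)).
  case=> c _ /(congr1 (P l)); rewrite proj_weighted_sum.
  rewrite [P j (_ + _)]linearD linearZ /= !PP eqxx (negbTE jk) scaler0 addr0.
  rewrite [T (_ + _)]linearD linearZ [P l (_ + _)]linearD linearZ.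
  by exists (c l).
have [c uE] := main 1; rewrite scale1r in uE.
have c0 : c != 0 by apply: contraNneq u0 => c0; rewrite uE c0 scale0r.
have vE : v = (c^-1 - 1) *: u.
  by rewrite scalerBl scale1r {1}uE scalerA mulVf // scale1r addrC addKr.
have t0 : c^-1 - 1 != 0 by apply: contraNneq v0 => t0; rewrite vE t0 scale0r.
have [d] := main (- (c^-1 - 1)^-1).
rewrite vE scalerA mulNr mulVf // scaleN1r subrr scaler0 => u_eq0.
by rewrite u_eq0 eqxx in u0.
Qed.

(** A vector in a single block is majorized by itself, hence so is its image under T. The weight
    must be 1 on each nonzero block of the image, and the weights sum to 1. *)
Lemma block_col_unique T j l k x y : preserves_block_majorization T ->
  P j (T (P k x)) != 0 -> P l (T (P k y)) != 0 -> j = l.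
Proof.
move=> hT a0 b0; apply/eqP; apply: contraT => jl.
have main z : (P j (T (P k z)) == 0) || (P l (T (P k z)) == 0).
  apply: contraT; rewrite negb_or => /andP[{}a0 {}b0].
  have := hT _ _ (proj_majorized k (P k z)); rewrite PP eqxx.
  case=> c [c0 c1] TE.
  have cE i : P i (T (P k z)) != 0 -> c i = 1.
    move=> i0; have /eqP := congr1 (P i) TE; rewrite proj_weighted_sum.
    rewrite -[X in X == _]scale1r -subr_eq0 -scalerBl scaler_eq0 (negbTE i0).
    by rewrite orbF subr_eq0 => /eqP.
  have := c1; rewrite (bigD1 j) //= (bigD1 l) 1?eq_sym //= !cE //.
  move/(canRL (addKr 1)); rewrite addNr => e.
  have h : 0 <= \sum_(i | (i != j) && (i != l)) c i by apply: sumr_ge0.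
  by have := ltr_wpDr h ltr01; rewrite e ltxx.
have ay : P j (T (P k y)) = 0.
  by have := main y; rewrite (negbTE b0) orbF => /eqP.
have bx : P l (T (P k x)) = 0.
  by have := main x; rewrite (negbTE a0) => /eqP.
(* The witnesses [x] and [y] may differ; their sum has both components nonzero. *)
have := main (x + y); rewrite !linearD /= ay bx addr0 add0r.
by rewrite (negbTE a0) (negbTE b0).
Qed.

Lemma preserves_block_majorizationP T :
  preserves_block_majorization T <->
  exists s : {perm I}, forall i x, P i (T x) = T (P (s i) x).
Proof.
split=> [hT|[s PT] x y [c [c0 c1] ->]]; last first.
  (* Block [i] of the image comes from block [s i], so it inherits that weight. *)
  exists (fun i => c (s i)).
    by split=> //; rewrite -c1 [RHS](reindex_inj (@perm_inj _ s)).
  rewrite linear_sum [LHS](reindex_inj (@perm_inj _ s)) /=.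
  by apply: eq_bigr => i _; rewrite linearZ /= PT.
pose e l k := (P l \o T \o P k)%VF != 0.
have eP l k : reflect (exists x, P l (T (P k x)) != 0) (e l k).
  apply: (iffP idP) => [/lfunPn[x]|[x]].
    by rewrite !comp_lfunE zero_lfunE; exists x.
  by apply: contraNneq => /lfunP/(_ x); rewrite !comp_lfunE zero_lfunE => ->.
have [|i j k /eP[x ex] /eP[y ey]|s sP] := @partial_injection_extends_perm I e.
- by move=> i j k /eP[x ex] /eP[y ey]; apply: block_row_unique hT ex ey.
- exact: block_col_unique hT ex ey.
have P0 l k x : k != s l -> P l (T (P k x)) = 0.
  by move=> ks; apply: contraNeq ks => h; apply/eqP/sP/eP; exists x.
(* Both sides equal P_i T P_(s i) x: the left by splitting the input, the right by splitting the
   output. *)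
exists s => i x; rewrite -[in LHS](sumP x) !linear_sum (bigD1 (s i)) //=.
rewrite big1 ?addr0 => [|k ki]; last exact: P0.
rewrite -[RHS]sumP (bigD1 i) //= big1 ?addr0 // => l li.
by apply: P0; rewrite (inj_eq perm_inj) eq_sym.
Qed.

Lemma drazin_inverse_preserves_block_majorization T :
  preserves_block_majorization T ->
  preserves_block_majorization (drazin_inverse T).
Proof.
move=> /preserves_block_majorizationP[s PT].
apply/preserves_block_majorizationP; exists (s^-1)%g => i x.
exact: drazin_inverse_intertwining.
Qed.

End BlockMajorization.

(** * Circulant diagonals as such a family of projections *)

Section CirculantDiagonals.
Variables (R : realType) (n : nat).
Implicit Types (D X Y : 'M[R]_n) (i j k : 'I_n).

Lemma hadamard_is_linear D : linear (hadamard D).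
Proof. by move=> a X Y; apply/matrixP=> i j; rewrite !mxE mulrDr mulrCA. Qed.

HB.instance Definition _ D :=
  GRing.isLinear.Build R _ _ _ (hadamard D) (hadamard_is_linear D).

Definition diag_proj k : 'End('M[R]_n) :=
  linfun (hadamard (circ_shift R n ^+ k.+1)).

Lemma circ_shiftX_E m i j :
  (circ_shift R n ^+ m) i j = (i == iter m (@ord_pred n) j)%:R.
Proof.
elim: m i j => [|m IHm] i j; first by rewrite expr0 mxE.
rewrite exprSr mxE (bigD1 (ord_pred j)) //= IHm mxE eqxx mulr1 big1 ?addr0.
  by rewrite -iterS iterSr.
by move=> k /negbTE kj; rewrite [circ_shift _ _ _ _]mxE kj mulr0.
Qed.

Lemma iter_ord_pred_mod m j : (iter m (@ord_pred n) j + m = j %[mod n])%N.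
Proof.
elim: m => [|m IHm]; first by rewrite addn0.
rewrite iterS -IHm; set y := iter m _ j.
(* The element [j] forces [0 < n], so the predecessor is not truncated. *)
have yn : (0 < y + n)%N by rewrite addn_gt0 (leq_trans _ (ltn_ord j)) ?orbT.
by rewrite /= modnDml addnS -addSn prednK // addnAC modnDr.
Qed.

Lemma iter_ord_pred_inj j : injective (fun k => iter k.+1 (@ord_pred n) j).
Proof.
move=> k l kl; apply: val_inj => /=.
have := iter_ord_pred_mod k.+1 j; rewrite kl -(iter_ord_pred_mod l.+1 j).
by move/eqP; rewrite eqn_modDl -(addn1 k) -(addn1 l) eqn_modDr !modn_small // => /eqP.
Qed.

(** An injective self-map of a finite type is invertible, so each entry lies on exactly one
    circulant diagonal. *)
Definition diag_index i j : 'I_n := invF (@iter_ord_pred_inj j) i.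

Lemma circ_shift_powE k i j :
  (circ_shift R n ^+ k.+1) i j = (k == diag_index i j)%:R.
Proof.
rewrite circ_shiftX_E; congr (_%:R); congr nat_of_bool.
have /= iE := f_invF (@iter_ord_pred_inj j) i.
by rewrite -[in LHS]iE (inj_eq (@iter_ord_pred_inj j)) eq_sym.
Qed.

Lemma diag_projE k X i j : diag_proj k X i j = (k == diag_index i j)%:R * X i j.
Proof. by rewrite lfunE mxE circ_shift_powE. Qed.

Lemma diag_projP k l X :
  diag_proj k (diag_proj l X) = if k == l then diag_proj l X else 0.
Proof.
apply/matrixP => i j; rewrite !diag_projE.
have [->|kl] := eqVneq k l.
  by rewrite diag_projE; case: eqP; rewrite ?mul1r ?mul0r.
rewrite mxE; have [<-|_] := eqVneq k; last by rewrite mul0r.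
by rewrite eq_sym (negbTE kl) mul0r mulr0.
Qed.

Lemma sum_diag_proj X : \sum_k diag_proj k X = X.
Proof.
apply/matrixP => i j; rewrite summxE (bigD1 (diag_index i j)) //= big1.
  by rewrite diag_projE eqxx mul1r addr0.
by move=> k /negbTE kd; rewrite diag_projE kd mul0r.
Qed.

Lemma hadamard_circulant (c : 'I_n -> R) Y :
  hadamard (\sum_i c i *: circ_shift R n ^+ i.+1) Y = \sum_i c i *: diag_proj i Y.
Proof.
apply/matrixP => i j; rewrite mxE !summxE mulr_suml.
by apply: eq_bigr => k _; rewrite lfunE !mxE mulrA.
Qed.

Lemma HC_majorizedP X Y : HC_majorized X Y <-> block_majorized diag_proj X Y.
Proof.
split=> [[D [c [c0 c1 ->]] ->]|[c [c0 c1] ->]].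
  by exists c; rewrite ?hadamard_circulant.
exists (\sum_i c i *: circ_shift R n ^+ i.+1); first by exists c.
by rewrite hadamard_circulant.
Qed.

Lemma preserves_HC_majorizationP (T : 'End('M[R]_n)) :
  preserves_HC_majorization T <-> preserves_block_majorization diag_proj T.
Proof.
by split=> hT X Y /HC_majorizedP XY; apply/HC_majorizedP; apply: hT.
Qed.

End CirculantDiagonals.

Theorem theorem2p6 (R : realType) (n : nat) (hn : (0 < n)%N)
    (T : 'End('M[R]_n)) (hT : preserves_HC_majorization T) :
  preserves_HC_majorization (drazin_inverse T).
Proof.
apply/preserves_HC_majorizationP.
apply: drazin_inverse_preserves_block_majorization.
- exact: diag_projP.
- exact: sum_diag_proj.
- exact/preserves_HC_majorizationP.
Qed.
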